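(* Let $R$ be an exchange ring of bounded index in which the set $\operatorname{Nil}(R)$ of nilpotent elements is a subring. Then $\operatorname{Nil}(R)$ is an ideal of $R$.
   Context: Rings are associative and not necessarily unital. For $x,y\in R$ write $x\circ y=x+y-xy$. $R$ is an exchange ring if for every $a\in R$ there exist an idempotent $e\in R$ and $r,s\in R$ with $e=ra=s\circ a$. $R$ is of bounded index if there is a positive integer $n$ such that $x^n=0$ for all $x\in\operatorname{Nil}(R)$. *)

(* Defs.v *)
From HB Require Import structures.
From mathcomp Require Import all_boot all_algebra.
Set Implicit Arguments. Unset Strict Implicit. Unset Printing Implicit Defensive.
Import GRing.Theory.
Local Open Scope ring_scope.

(* Associative, not necessarily unital rings ("rngs"): an abelian group with
   an associative multiplication distributing over addition on both sides.
   MathComp's ring structures all have a unit, so we define this here. *)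
HB.mixin Record Zmodule_isRng V of GRing.Zmodule V := {
  rmul : V -> V -> V;
  rmulA : forall x y z, rmul x (rmul y z) = rmul (rmul x y) z;
  rmulDl : forall x y z, rmul (x + y) z = rmul x z + rmul y z;
  rmulDr : forall x y z, rmul x (y + z) = rmul x y + rmul x z;
}.

#[short(type="rngType")]
HB.structure Definition Rng := { V of Zmodule_isRng V & GRing.Zmodule V }.

Section RngDefs.
Variable R : rngType.

(* rpowS x n = x^(n+1) *)
Fixpoint rpowS (x : R) (n : nat) : R :=
  match n with 0%N => x | k.+1 => rmul x (rpowS x k) end.

(* x^n for n >= 1 *)
Definition rpow (x : R) (n : nat) : R := rpowS x n.-1.

Definition circ (x y : R) : R := x + y - rmul x y.

Definition idempotent (e : R) : Prop := rmul e e = e.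

Definition nilpotent (x : R) : Prop := exists n : nat, (0 < n)%N /\ rpow x n = 0.

Definition nilset : R -> Prop := nilpotent.

Definition exchange_ring : Prop :=
  forall a : R, exists e r s : R, idempotent e /\ e = rmul r a /\ e = circ s a.

Definition bounded_index : Prop :=
  exists n : nat, (0 < n)%N /\ forall x : R, nilset x -> rpow x n = 0.

Definition is_subring (S : R -> Prop) : Prop :=
  [/\ S 0, (forall x y, S x -> S y -> S (x - y)) & (forall x y, S x -> S y -> S (rmul x y))].

Definition is_ideal (S : R -> Prop) : Prop :=
  [/\ S 0, (forall x y, S x -> S y -> S (x - y))
     & (forall r x, S x -> S (rmul r x) /\ S (rmul x r))].

End RngDefs.

(* Main.v *)
Require Import Defs.
From mathcomp Require Import all_boot all_algebra.

(** Write [N] for the set of nilpotents and [T] for the set of [x] with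
    [xR] contained in [N].  Since [N] is additively closed, [T] is an ideal
    inside [N], and [xRx] contained in [T] forces [x] into [T]; the claim is
    that [N = T].  By descent on the exponent it is enough to show that if
    [x^(k+1)] lies in [T] for all [x] in [N] (with [k > 0]), then so does
    [a = c^k] for each [c] in [N].

    First, [ba] lies in [T] whenever [b^2] does.  Indeed [c^k r c] is in [N],
    hence so is [c^k r c b], that is, [c b c^k] is in [T].  Put [t = b c^k] and
    [x = t r b]; then [cx] and [x^2] are in [T], so modulo [T] the only
    surviving words in [(c + x)^(k+1)] give [x c^k = t r t], which is therefore
    in [T].

    If [e = sa] is idempotent, take [b = es(1 - e)]: then [e] is congruent to
    [e s e a], hence to [e s e s e a^2], modulo [T], so that [e = 0].  The
    exchange property now makes every element of [Ra] quasi-regular, hence also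
    [y = rar].  Conjugating [a] by [1 - y] gives an element [b] with [b^2] in
    [T], and [ba] in [T] amounts to [aya = arara] in [T].  So [ar] is nilpotent
    for all [r]. *)

Set Implicit Arguments.
Unset Strict Implicit.
Unset Printing Implicit Defensive.
Import GRing.Theory.
Local Open Scope ring_scope.

Local Notation "x * y" := (rmul x y) : ring_scope.

(** * Powers, nilpotency and quasi-inverses in a ring without unit *)

Section RngTheory.
Variable R : rngType.
Implicit Types x y z : R.

Lemma rmul0r x : 0 * x = 0.
Proof. by apply: (@addrI _ (0 * x)); rewrite -rmulDl !addr0. Qed.

Lemma rmulr0 x : x * 0 = 0.
Proof. by apply: (@addrI _ (x * 0)); rewrite -rmulDr !addr0. Qed.

Lemma rmulNr x y : - x * y = - (x * y).
Proof. by apply: (@addrI _ (x * y)); rewrite -rmulDl !subrr rmul0r. Qed.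

Lemma rmulrN x y : x * - y = - (x * y).
Proof. by apply: (@addrI _ (x * y)); rewrite -rmulDr !subrr rmulr0. Qed.

Lemma rmulBl x y z : (x - y) * z = x * z - y * z.
Proof. by rewrite rmulDl rmulNr. Qed.

Lemma rmulBr x y z : x * (y - z) = x * y - x * z.
Proof. by rewrite rmulDr rmulrN. Qed.

Lemma rpowSD x i j : rpowS x i * rpowS x j = rpowS x (i + j).+1.
Proof. by elim: i => [//|i IHi] /=; rewrite -rmulA IHi. Qed.

Lemma rpowSM x i j : rpowS (rpowS x i) j = rpowS x (i.+1 * j.+1).-1.
Proof.
elim: j => [|j IHj]; first by rewrite muln1.
by rewrite [LHS]/= IHj rpowSD -addnS prednK // [in RHS]mulnS.
Qed.

Lemma rpowS_idempotent e k : Defs.idempotent e -> rpowS e k = e :> R.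
Proof. by move=> ee; elim: k => [//|k IHk] /=; rewrite IHk. Qed.

Lemma rpowS_mulC x y k : rpowS (y * x) k.+1 = y * (rpowS (x * y) k * x).
Proof.
elim: k => [|k IHk]; first by rewrite /= !rmulA.
by rewrite [LHS]/= -/(rpowS (y * x) k.+1) IHk /= !rmulA.
Qed.

Lemma nilpotentP x : nilpotent x <-> exists k, rpowS x k = 0.
Proof.
split=> [[[|k] [// _ xk0]]|[k xk0]]; first by exists k.
by exists k.+1.
Qed.

Lemma nilpotent0 : nilpotent (0 : R).
Proof. by apply/nilpotentP; exists 0. Qed.

Lemma nilpotent_rpowS x k : nilpotent (rpowS x k) -> nilpotent x.
Proof.
move/nilpotentP=> [j]; rewrite rpowSM => xkj0.
by apply/nilpotentP; exists (k.+1 * j.+1).-1.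
Qed.

Lemma nilpotent_mulC x y : nilpotent (x * y) -> nilpotent (y * x).
Proof.
move/nilpotentP=> [k xyk]; apply/nilpotentP; exists k.+1.
by rewrite rpowS_mulC xyk rmul0r rmulr0.
Qed.

Lemma idempotent_nilpotent_eq0 x : Defs.idempotent x -> nilpotent x -> x = 0.
Proof. by move=> ix /nilpotentP[k]; rewrite rpowS_idempotent. Qed.

(* A left quasi-inverse which itself has a left quasi-inverse is two-sided. *)
Lemma quasi_inverse_two_sided x y z :
  y + x = y * x -> z + y = z * y -> x * y = x + y.
Proof.
move=> yx zy; suff <- : z = x by rewrite zy.
apply: (@addIr _ y); rewrite zy addrC yx.
by apply: (@addIr _ (z * x)); rewrite -rmulDr yx rmulA -zy rmulDl addrC.
Qed.

(* From (1 - y)^-1 = 1 + x (1 - q) s for y = x s and 1 - q = (1 - s x)^-1. *)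
Lemma quasi_inverse_swap x s q :
  (s * x) * q = s * x + q ->
  (x * s) * (x * q * s - x * s) = x * s + (x * q * s - x * s).
Proof.
move=> sxq; rewrite rmulBr [RHS]addrC subrK.
have -> : x * s * (x * q * s) = x * (s * x * q) * s by rewrite !rmulA.
by rewrite sxq rmulDr rmulDl !rmulA addrAC subrr add0r.
Qed.

End RngTheory.

Definition nil_core (R : rngType) (x : R) : Prop := forall r, nilpotent (x * r).

(** * The ideal [T] of elements with nilpotent right multiples *)

Section NilCore.
Variable R : rngType.
Hypothesis nilS : is_subring (@nilset R).
Local Notation N := (@nilpotent R).
Local Notation T := (@nil_core R).
Implicit Types a b c e r s x y z : R.

Lemma nilpotentB x y : N x -> N y -> N (x - y).
Proof. by case: nilS => _ + _; apply. Qed.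

Lemma nilpotentN x : N x -> N (- x).
Proof. by move=> Nx; rewrite -sub0r; apply: nilpotentB => //; apply: nilpotent0. Qed.

Lemma nilpotentD x y : N x -> N y -> N (x + y).
Proof.
by move=> Nx Ny; rewrite -[y]opprK; apply: nilpotentB => //; apply: nilpotentN.
Qed.

Lemma nilpotentM x y : N x -> N y -> N (x * y).
Proof. by case: nilS => _ _; apply. Qed.

Lemma nil_core0 : T 0.
Proof. by move=> r; rewrite rmul0r; apply: nilpotent0. Qed.

Lemma nil_coreN x : T x -> T (- x).
Proof. by move=> Tx r; rewrite rmulNr; apply: nilpotentN. Qed.

Lemma nil_coreD x y : T x -> T y -> T (x + y).
Proof. by move=> Tx Ty r; rewrite rmulDl; apply: nilpotentD. Qed.

Lemma nil_coreB x y : T x -> T y -> T (x - y).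
Proof. by move=> Tx Ty; apply: nil_coreD => //; apply: nil_coreN. Qed.

Lemma nil_coreMr x y : T x -> T (x * y).
Proof. by move=> Tx r; rewrite -rmulA. Qed.

Lemma nil_coreMl x y : T y -> T (x * y).
Proof. by move=> Ty r; rewrite -rmulA; apply: nilpotent_mulC; rewrite -rmulA. Qed.

(** Without a unit [x] need not lie in [xR], but [x * x] does, and roots of nilpotents are
    nilpotent. *)
Lemma nil_core_nilpotent x : T x -> N x.
Proof. by move=> /(_ x) Nxx; apply: (@nilpotent_rpowS _ _ 1). Qed.

Lemma nil_core_sqr_nilpotent x : T (x * x) -> N x.
Proof. by move/nil_core_nilpotent; apply: (@nilpotent_rpowS _ _ 1). Qed.

Lemma nil_core_rpowS_le x i j : (i <= j)%N -> T (rpowS x i) -> T (rpowS x j).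
Proof.
move=> /subnK <- Txi; elim: (j - i)%N => // k IHk.
exact: nil_coreMl.
Qed.

Lemma nil_core_semiprime x : (forall r, T (x * r * x)) -> T x.
Proof.
move=> Txrx r; apply: nil_core_sqr_nilpotent; rewrite rmulA.
exact: nil_coreMr.
Qed.

Lemma nil_core_rpowSD c x k :
  T (c * x) -> T (x * x) -> T (rpowS (c + x) k.+1 - (rpowS c k.+1 + x * rpowS c k)).
Proof.
move=> Tcx Txx; elim: k => [|k IHk].
  rewrite /= rmulDr !rmulDl addrAC subrr add0r.
  exact: nil_coreD.
set p := rpowS (c + x) k.+1 in IHk *; set q := rpowS c k in IHk *.
have -> : rpowS (c + x) k.+2 = (c + x) * p by [].
have -> : rpowS c k.+2 = c * (c * q) by [].
rewrite [rpowS c k.+1]/= -/q in IHk *.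
have -> : p = (p - (c * q + x * q)) + (c * q + x * q) by rewrite subrK.
rewrite rmulDr -addrA; apply: nil_coreD; first exact: nil_coreMl.
rewrite rmulDr !rmulDl addrAC subrr add0r.
by rewrite !rmulA; apply: nil_coreD; apply: nil_coreMr.
Qed.

(** * One descent step, from exponent m+2 to m+1 *)

Section Descent.
Variable m : nat.
Hypothesis nil_pow : forall x, N x -> T (rpowS x m.+1).
Variable c : R.
Hypothesis Nc : N c.
Local Notation a := (rpowS c m).

Lemma nil_core_sandwich b : N b -> T (c * b * a).
Proof.
move=> Nb r; rewrite -rmulA; apply: nilpotent_mulC; rewrite rmulA.
apply: nilpotentM => //; apply: nil_core_sqr_nilpotent.
(* The inner [c * a] is c^(m+2), which lies in [T]. *)
have -> : a * r * c * (a * r * c) = a * r * (c * a) * r * c by rewrite !rmulA.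
by do 2!apply: nil_coreMr; apply: nil_coreMl; apply: nil_pow.
Qed.

Lemma nil_core_sqr_mul b : T (b * b) -> T (b * a).
Proof.
move=> Tbb; have Tcba := nil_core_sandwich (nil_core_sqr_nilpotent Tbb).
apply: nil_core_semiprime => r; pose x := b * a * r * b.
have Tcx : T (c * x) by rewrite /x !rmulA; do 2!apply: nil_coreMr.
have Txx : T (x * x).
  have -> : x * x = b * a * r * (b * b) * (a * r * b) by rewrite /x !rmulA.
  by apply: nil_coreMr; apply: nil_coreMl.
have Nx := nil_core_sqr_nilpotent Txx.
have := nil_coreB (nil_pow (nilpotentD Nc Nx)) (nil_core_rpowSD m Tcx Txx).
rewrite opprB addrCA subrr addr0 => /nil_coreB/(_ (nil_pow Nc)).
by rewrite addrC addKr /x -!rmulA.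
Qed.

Lemma nil_core_sqr : T (a * a).
Proof.
rewrite rpowSD; apply: (@nil_core_rpowS_le _ m.+1); last exact: nil_pow.
by rewrite ltnS leq_addr.
Qed.

Lemma idempotent_left_multiple_eq0 e s : Defs.idempotent e -> e = s * a -> e = 0.
Proof.
move=> ee esa; have Ta2 := nil_core_sqr.
pose b := e * s - e * s * e.
have be : b * e = 0 by rewrite rmulBl -!rmulA ee subrr.
have Tba : T (b * a).
  apply: nil_core_sqr_mul; have -> : b * b = b * e * (s - s * e).
    by rewrite -rmulA rmulBr rmulA.
  by rewrite be rmul0r; apply: nil_core0.
have Te : T (e - e * s * e * a).
  by move: Tba; rewrite rmulBl -[e * s * a]rmulA -esa ee.
apply: idempotent_nilpotent_eq0 => //; apply: nil_core_nilpotent.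
rewrite -(subrK (e * s * e * a) e); apply: nil_coreD => //.
(* Replacing the right-hand [e] by e s e a modulo [T] creates the factor [a * a]. *)
have -> : e * s * e * a =
    e * s * (e - e * s * e * a) * a + e * s * e * s * e * (a * a).
  by rewrite rmulBr rmulBl !rmulA subrK.
by apply: nil_coreD; [apply: nil_coreMr; apply: nil_coreMl | apply: nil_coreMl].
Qed.

(** As (1 - y)(1 - z) = 1, b = (1 - z) a (1 - y) has b^2 = (1 - z) a^2 (1 - y) in [T], so [T]
    contains b a and (1 - y) b a = a (1 - y) a. *)
Lemma nil_core_conj y z : y * z = y + z -> T (a * y * a).
Proof.
move=> yz; have Ta2 := nil_core_sqr.
(* In the unitization, w = a (1 - y) and b = (1 - z) a (1 - y). *)
pose w := a - a * y; pose b := w - z * w.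
have wK x : w * (x - z * x) = a * x.
  rewrite rmulBr !rmulBl.
  have -> : a * y * (z * x) = a * y * x + a * (z * x).
    by rewrite rmulA -[a * y * z]rmulA yz rmulDr rmulDl !rmulA.
  by rewrite opprB addrK subrK.
have Taw : T (a * w) by rewrite rmulBr rmulA; apply: nil_coreB => //; apply: nil_coreMr.
have Tba : T (b * a).
  apply: nil_core_sqr_mul; rewrite {1}/b rmulBl -rmulA wK.
  by apply: nil_coreB => //; apply: nil_coreMl.
have ybE : y * (b * a) = - (z * (w * a)).
  rewrite /b rmulBl rmulBr -[z * w * a]rmulA [y * (z * _)]rmulA yz (rmulDl y z).
  by rewrite opprD addrA subrr add0r.
have Twa : T (w * a).
  have -> : w * a = b * a - y * (b * a).
    by rewrite ybE opprK /b rmulBl rmulA subrK.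
  by apply: nil_coreB => //; apply: nil_coreMl.
have -> : a * y * a = a * a - w * a by rewrite rmulBl opprB addrC subrK.
exact: nil_coreB.
Qed.

Hypothesis exR : exchange_ring R.

(** Exchange for [s * a] yields an idempotent in [Ra], which is 0. As [q] is again in [Ra], the
    lemma applies to it in turn. *)
Lemma left_quasi_inverse s :
  exists2 q, q + s * a = q * (s * a) & exists s', q = s' * a.
Proof.
have [e [r [q [ee [era eq]]]]] := exR (s * a).
have e0 : e = 0.
  by apply: (idempotent_left_multiple_eq0 (s := r * s)) => //; rewrite -rmulA.
have qE : q + s * a = q * (s * a).
  by apply: subr0_eq; rewrite -e0 eq.
exists q => //; exists (q * s - s).
by rewrite rmulBl -rmulA -qE addrK.
Qed.

Lemma nil_core_descent : T a.
Proof.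
(* With [r * r], moving one [r] across turns r(ra) into (ra)r. *)
move=> r; have [q qd [s qE]] := left_quasi_inverse (r * r).
have [q' q'q _] := left_quasi_inverse s; rewrite -qE in q'q.
have dq := quasi_inverse_two_sided qd q'q.
have Tarara : T (a * (r * a * r) * a).
  by apply: nil_core_conj; apply: (quasi_inverse_swap (q := q)); rewrite rmulA.
apply: (@nilpotent_rpowS _ _ 2); apply: nil_core_nilpotent.
have -> : rpowS (a * r) 2 = a * (r * a * r) * a * r by rewrite /= !rmulA.
exact: nil_coreMr.
Qed.

End Descent.

Lemma nilpotent_nil_core :
  exchange_ring R -> bounded_index R -> forall x, N x -> T x.
Proof.
move=> exR [[|n] [n_gt0 nilpow]] //.
have : forall x, N x -> T (rpowS x n).
  by move=> x /nilpow xn0; rewrite -[rpowS x n]/(rpow x n.+1) xn0; apply: nil_core0.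
(* The descent ends at n = 0, where [rpowS x 0] is [x]. *)
elim: n {n_gt0 nilpow} => [//|n IHn] Tpow; apply: IHn => x Nx.
exact: nil_core_descent.
Qed.

End NilCore.

Theorem theorem3p7 (R : rngType) :
  exchange_ring R -> bounded_index R -> is_subring (@nilset R) -> is_ideal (@nilset R).
Proof.
move=> exR bdR nilS; case: (nilS) => nil0 nilB _; split=> // r x Nx.
have Tx := nilpotent_nil_core nilS exR bdR Nx.
by split; apply: nil_core_nilpotent; [apply: nil_coreMl | apply: nil_coreMr].
Qed.
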